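(* An Abelian group $G$ with maximal torsion subgroup $T$ is fully generalized co-Bassian if and only if it is co-Bassian, i.e., if and only if $G/T$ is divisible of finite rank and, for each prime $p$, $T_p$ has finite $p$-rank.
   Context: All groups are Abelian, written additively. An injection between groups means an injective homomorphism. $T = T(G)$ is the maximal torsion subgroup of $G$ and $T_p$ is its $p$-primary component. The $p$-rank of $T_p$ is the dimension of its socle $T_p[p] = \{x \in T_p : px = 0\}$ over the field with $p$ elements. A subgroup $F$ of a group $X$ is fully invariant if $\psi(F) \subseteq F$ for every endomorphism $\psi$ of $X$. A group $G$ is co-Bassian if, for every subgroup $H \leq G$ and every injection $\phi : G \to G/H$, $\phi(G) = G/H$. A group $G$ is fully generalized co-Bassian if, for every subgroup $H \leq G$ and every injection $\phi : G \to G/H$, $\phi(G)$ is a fully invariant direct summand of $G/H$. *)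

(* Defs.v *)
From HB Require Import structures.
From mathcomp Require Import all_boot all_order all_algebra.
From mathcomp Require Import boolp.

Set Implicit Arguments.
Unset Strict Implicit.
Unset Printing Implicit Defensive.

Import GRing.Theory.

Local Open Scope ring_scope.

(* An Abelian group is a [zmodType], a subgroup of it a [zmodClosed] predicate
   (classically no restriction, through [asbool]), G/H is [Quotient.quot H],
   and a homomorphism is an additive map. *)

Definition image_of (X Y : zmodType) (phi : {additive X -> Y}) : {pred Y} :=
  fun y => `[< exists x, phi x = y >].

Lemma image_of_closed (X Y : zmodType) (phi : {additive X -> Y}) :
  zmod_closed (image_of phi).
Proof.
split; first by apply/asboolP; exists 0; rewrite raddf0.
move=> _ _ /asboolP[x <-] /asboolP[y <-]; apply/asboolP.
by exists (x - y); rewrite raddfB.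
Qed.

HB.instance Definition _ (X Y : zmodType) (phi : {additive X -> Y}) :=
  GRing.isZmodClosed.Build Y (image_of phi) (image_of_closed phi).

Definition fully_invariant (X : zmodType) (F : zmodClosed X) : Prop :=
  forall (psi : {additive X -> X}) (x : X), x \in F -> psi x \in F.

Definition direct_summand (X : zmodType) (F : zmodClosed X) : Prop :=
  exists K : zmodClosed X,
    (forall x : X, x \in F -> x \in K -> x = 0) /\
    (forall x : X, exists f k : X, [/\ f \in F, k \in K & x = f + k]).

Definition co_Bassian (G : zmodType) : Prop :=
  forall (H : zmodClosed G) (phi : {additive G -> Quotient.quot H}),
    injective phi -> image_of phi =i predT.

Definition fully_generalized_co_Bassian (G : zmodType) : Prop :=
  forall (H : zmodClosed G) (phi : {additive G -> Quotient.quot H}),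
    injective phi ->
    fully_invariant (image_of phi) /\ direct_summand (image_of phi).

Definition torsion (G : zmodType) : {pred G} :=
  fun x => `[< exists2 n : nat, (0 < n)%N & x *+ n = 0 >].

Lemma torsion_closed (G : zmodType) : zmod_closed (@torsion G).
Proof.
split; first by apply/asboolP; exists 1%N.
move=> x y /asboolP[m m0 xm] /asboolP[n n0 yn]; apply/asboolP.
exists (m * n)%N; first by rewrite muln_gt0 m0.
by rewrite mulrnBl mulrnA xm mul0rn mulnC mulrnA yn mul0rn subrr.
Qed.

HB.instance Definition _ (G : zmodType) :=
  GRing.isZmodClosed.Build G (@torsion G) (@torsion_closed G).

Definition primary_component (G : zmodType) (p : nat) : {pred G} :=
  fun x => (x \in @torsion G) && `[< exists k : nat, x *+ (p ^ k)%N = 0 >].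

Lemma primary_component_closed (G : zmodType) (p : nat) :
  zmod_closed (@primary_component G p).
Proof.
split; first by apply/andP; split; [exact: rpred0|apply/asboolP; exists 0%N].
move=> x y /andP[xT /asboolP[m xm]] /andP[yT /asboolP[n yn]].
apply/andP; split; first exact: rpredB.
apply/asboolP; exists (m + n)%N; rewrite expnD mulrnBl mulrnA xm mul0rn.
by rewrite mulnC mulrnA yn mul0rn subrr.
Qed.

HB.instance Definition _ (G : zmodType) (p : nat) :=
  GRing.isZmodClosed.Build G (@primary_component G p)
    (@primary_component_closed G p).

Definition socle (G : zmodType) (p : nat) : {pred G} :=
  fun x => (x \in @primary_component G p) && (x *+ p == 0).

Lemma socle_closed (G : zmodType) (p : nat) : zmod_closed (@socle G p).
Proof.
split; first by apply/andP; split; [exact: rpred0|rewrite mul0rn].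
move=> x y /andP[xT /eqP xp] /andP[yT /eqP yp]; apply/andP; split.
  exact: rpredB.
by rewrite mulrnBl xp yp subrr.
Qed.

HB.instance Definition _ (G : zmodType) (p : nat) :=
  GRing.isZmodClosed.Build G (@socle G p) (@socle_closed G p).

(* T_p[p] as a vector space over 'F_p, which has p elements only when p is
   prime; hence the proof argument. *)
Record socle_space (G : zmodType) (p : nat) (p_pr : prime p) : Type :=
  SocleSpace { socle_val : G; _ : socle_val \in @socle G p }.

Section SocleSpace.
Variables (G : zmodType) (p : nat) (p_pr : prime p).
Local Notation V := (socle_space G p_pr).

HB.instance Definition _ := [isSub of V for @socle_val G p p_pr].
HB.instance Definition _ := [Choice of V by <:].
HB.instance Definition _ := [SubChoice_isSubZmodule of V by <:].

Definition socle_scale (a : 'F_p) (v : V) : V := v *+ (a : nat).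

Lemma socle_mulrn_mod (v : V) (n : nat) :
  v *+ (n %% (Zp_trunc (pdiv p)).+2)%N = v *+ n.
Proof.
have vp : v *+ p = 0.
  apply: val_inj; rewrite raddfMn raddf0.
  by case/andP: (valP v) => _ /eqP.
by rewrite Fp_cast // [in RHS](divn_eq n p) mulrnDr mulnC mulrnA vp mul0rn add0r.
Qed.

Lemma socle_scaleA (a b : 'F_p) (v : V) :
  socle_scale a (socle_scale b v) = socle_scale (a * b) v.
Proof. by rewrite /socle_scale socle_mulrn_mod -mulrnA mulnC. Qed.

Lemma socle_scale1 : left_id 1 socle_scale.
Proof. by []. Qed.

Lemma socle_scaleDr : right_distributive socle_scale +%R.
Proof. by move=> a u v; rewrite /socle_scale mulrnDl. Qed.

Lemma socle_scaleDl (v : V) : {morph socle_scale^~ v : a b / a + b}.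
Proof. by move=> a b; rewrite /socle_scale socle_mulrn_mod mulrnDr. Qed.

HB.instance Definition _ := GRing.Zmodule_isLmodule.Build 'F_p V
  socle_scaleA socle_scale1 socle_scaleDr socle_scaleDl.

End SocleSpace.

Definition finite_p_rank (G : zmodType) (p : nat) (p_pr : prime p) : Prop :=
  exists n : nat, inhabited (@Vector.axiom 'F_p n (socle_space G p_pr)).

Definition divisible (A : zmodType) : Prop :=
  forall (n : nat) (x : A), (0 < n)%N -> exists y : A, y *+ n = x.

Definition independent (A : zmodType) (m : nat) (x : 'I_m -> A) : Prop :=
  forall c : 'I_m -> int, \sum_i x i *~ c i = 0 -> forall i, c i = 0.

(* Linear independence over the integers: this is the torsion-free rank, which
   is the rank of A when A is torsion-free, as G/T is. *)
Definition finite_rank (A : zmodType) : Prop :=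
  exists n : nat, forall (m : nat) (x : 'I_m -> A),
    independent x -> (m <= n)%N.

(* Main.v *)
(* If a fully generalized co-Bassian G had G/H = phi(G) + K with K <> 0, the
   endomorphism sending phi(g) + k to the K-component of the class of g would
   move phi(G) into K nontrivially; so phi(G) = G/H.

   For a co-Bassian G, every obstruction has the same shape: a subgroup C of G
   and two homomorphisms q, i : G -> D such that q maps C onto q(G) + i(G), and i
   embeds C without reaching all of q(G); then G embeds properly into a quotient
   of itself.  Infinite torsion-free rank gives C free of countable rank and
   D = Q^(omega); an infinite p-socle gives C a countable direct sum of cyclic
   p-groups and D = Z(p^oo)^(omega), the maps extending from C to G because D is
   divisible.  Once G[p] is finite, T_p has a complement C, and C -> G/T_p with
   its p-th multiple shows that G/T is p-divisible.

   Conversely, under the three finiteness conditions H is torsion by counting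
   ranks, so phi is onto modulo torsion, and it is onto the m-torsion of G/H
   because a finite subgroup of G/H killed by m has at most |G[m]| elements. *)

Require Import Defs.
From HB Require Import structures.
From mathcomp Require Import all_boot all_order all_algebra.
From mathcomp Require Import boolp classical_sets.
From mathcomp Require Import zify.

Set Implicit Arguments.
Unset Strict Implicit.
Unset Printing Implicit Defensive.

Import Order.TTheory GRing.Theory Num.Theory.

Local Open Scope ring_scope.

(** * Subgroups and Zorn's lemma *)

Section Subgroups.
Variable X : zmodType.

Definition is_subgroup (B : X -> Prop) :=
  B 0 /\ forall x y, B x -> B y -> B (x - y).

Lemma subgroup_of (B : X -> Prop) :
  is_subgroup B -> exists M : zmodClosed X, forall x, (x \in M) <-> B x.
Proof.
move=> [B0 BB]; pose P : {pred X} := fun x => `[< B x >].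
have cP : zmod_closed P.
  split=> [|x y]; first exact/asboolP.
  by move=> /asboolP Bx /asboolP By; apply/asboolP; apply: BB.
pose M : zmodClosed X := HB.pack P (GRing.isZmodClosed.Build X P cP).
by exists M => x; split=> /asboolP.
Qed.

(** Zorn's lemma for the subgroups that contain [A] and miss [S]; by maximality, [M] and any further
    [g] generate a subgroup that meets [S]. *)
Lemma maximal_avoiding (A : zmodClosed X) (S : X -> Prop) :
  (forall x, x \in A -> ~ S x) ->
  exists M : zmodClosed X,
    [/\ {subset A <= M}, forall x, x \in M -> ~ S x
      & forall g, g \notin M ->
          exists2 c, c \in M & exists n : int, S (c + g *~ n)].
Proof.
move=> AS.
pose good (B : set X) :=
  [/\ is_subgroup B, forall x, x \in A -> B x & forall x, B x -> ~ S x].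
pose P (B : set X) := B = set0 \/ good B.
pose A' : set X := fun x => x \in A.
have goodA : good A'.
  split=> //; split=> [|x y]; first exact: rpred0.
  exact: rpredB.
have [F FP totF|B [PB maxB]] := @Zorn_bigcup X P.
  have [FE|/existsNP[B0 /not_implyP[FB0 /eqP nB0]]] :=
    pselect (forall B, F B -> B = set0).
    by left; apply/seteqP; split=> // x [B /FE -> ].
  have gB B x : F B -> B x -> good B.
    by move=> /FP[->|//].
  have /set0P[b0 B0b] := nB0.
  have gB0 := gB _ _ FB0 B0b.
  right; split.
  - split; first by exists B0 => //; have [[]] := gB0.
    move=> x y [B FB Bx] [C FC Cy].
    have [[_ HB] _ _] := gB _ _ FB Bx; have [[_ HC] _ _] := gB _ _ FC Cy.
    have [BC|CB] := totF _ _ FB FC.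
      by exists C => //; apply: HC => //; apply: BC.
    by exists B => //; apply: HB => //; apply: CB.
  - by move=> x xA; exists B0 => //; have [_ + _] := gB0; apply.
  - by move=> x [B FB Bx]; have [_ _] := gB _ _ FB Bx; apply.
have {PB} [B0|[sgB AB BS]] := PB.
  case: (maxB A'); last by right.
  rewrite B0; split; first exact: sub0set.
  by move=> /(_ 0 (rpred0 A)).
have [M ME] := subgroup_of sgB.
exists M; split=> [x /AB /ME //|x /ME /BS //|g /negP gM].
apply: contrapT => nS.
pose C : set X := fun x => exists2 c, c \in M & exists n : int, x = c + g *~ n.
apply: (maxB C); last first.
  right; split.
  - split; first by exists 0; [exact: rpred0|exists 0; rewrite mulr0z addr0].
    move=> _ _ [c cM [n ->]] [d dM [m ->]].
    exists (c - d); first exact: rpredB.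
    by exists (n - m); rewrite mulrzBr opprD addrACA.
  - move=> x /AB /ME xM; exists x => //; exists 0; by rewrite mulr0z addr0.
  - by move=> _ [c cM [n ->]] Sx; apply: nS; exists c => //; exists n.
split=> [x /ME xM|/(_ g) Cg]; first by exists x => //; exists 0; rewrite mulr0z addr0.
apply/gM/ME/Cg; exists 0; first exact: rpred0.
by exists 1; rewrite mulr1z add0r.
Qed.

End Subgroups.

(** * Homomorphisms and quotient groups *)

Lemma additive_of (X Y : zmodType) (f : X -> Y) :
  {morph f : x y / x - y} -> exists g : {additive X -> Y}, g =1 f.
Proof.
move=> fB.
pose g : {additive X -> Y} := HB.pack f (GRing.isZmodMorphism.Build X Y f fB).
by exists g.
Qed.

Section Quotients.
Variables (X : zmodType) (H : zmodClosed X).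

Definition quot_proj (x : X) : Quotient.quot H := \pi_(Quotient.quot H)%qT x.

Lemma quot_proj_is_zmod_morphism : zmod_morphism quot_proj.
Proof. exact: raddfB. Qed.

HB.instance Definition _ :=
  GRing.isZmodMorphism.Build X (Quotient.quot H) quot_proj
    quot_proj_is_zmod_morphism.

Lemma quot_proj_surj (b : Quotient.quot H) : exists x, quot_proj x = b.
Proof. by exists (repr b); rewrite /quot_proj reprK. Qed.

Lemma quot_proj_eq0 (x : X) : (quot_proj x == 0) = (x \in H).
Proof.
by rewrite -(raddf0 quot_proj) /quot_proj -Quotient.idealrBE subr0.
Qed.

End Quotients.

(** * Extension of homomorphisms into divisible groups *)

Lemma pair_mulrz (X Y : zmodType) (x : X) (y : Y) (n : int) :
  (x, y) *~ n = (x *~ n, y *~ n).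
Proof.
by apply: injective_projections; rewrite /= ?(raddfMz fst) ?(raddfMz snd).
Qed.

(** Baer's extension theorem, with [A] the graph of a homomorphism on a subgroup of [X]. The
    elements to avoid are the [(0, d)] with [d] nonzero, so that the maximal [M] is still
    single-valued. *)
Lemma extend_to_divisible (X D : zmodType) (A : zmodClosed (X * D)%type) :
  divisible D -> (forall d, (0, d) \in A -> d = 0) ->
  exists f : {additive X -> D}, forall x d, (x, d) \in A -> f x = d.
Proof.
move=> divD fnA.
have [|M [AM fnM maxM]] :=
    @maximal_avoiding _ A (fun z => z.1 = 0 /\ z.2 <> 0).
  by case=> x d /= xdA [x0]; apply; apply: fnA; rewrite -x0.
have {}fnM x d e : (x, d) \in M -> (x, e) \in M -> d = e.
  move=> dM eM; apply/eqP; rewrite -subr_eq0; apply/eqP; apply: contrapT => nde.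
  by apply: (fnM _ (rpredB dM eM)); split; rewrite //= subrr.
have totM g : exists d, (g, d) \in M.
  pose Q m := `[< (0 < m)%N /\ exists e, (g *+ m, e) \in M >].
  (* By maximality, [g] may be sent to [d] as soon as [d] agrees with [M] on every multiple of [g]
     in its domain. *)
  have step (d : D) : (forall (n : int) (e : D),
       (g *~ n, e) \in M -> e = d *~ n) -> (g, d) \in M.
    move=> dP; apply: contrapT => /negP /maxM[[c1 c2] cM [n /=]].
    rewrite pair_mulrz /=.
    move=> /= [/eqP]; rewrite addr_eq0 => /eqP cE; apply.
    rewrite -(dP n (- c2)) ?subrr //.
    by rewrite -rpredN; move: cM; rewrite cE -{1}(opprK c2).
  (* If no positive multiple of [g] is in the domain, 0 is a compatible value. *)
  have [[m0 Qm0]|nQ] := pselect (exists m, Q m); last first.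
    exists 0; apply: step => n e.
    have [->|n0] := eqVneq n 0.
      by rewrite !mulr0z => /fnM; apply; apply: rpred0.
    move=> ge; case: nQ; exists `|n|%N; apply/asboolP; split.
      by rewrite absz_gt0.
    case: n ge {n0} => n ge; first by exists e.
    exists (- e); rewrite NegzE mulrNz in ge.
    by rewrite -rpredN; move: ge; rewrite -{1}(opprK e).
  have exQ : exists m, Q m by exists m0.
  (* For the least such [m], an [m]-th part of the value at [g *+ m] is compatible, since division
     with remainder leaves only multiples of [g *+ m] in the domain. *)
  have [m /asboolP[m_gt0 [e ge]] minm] := ex_minnP exQ.
  have [d de] := divD m e m_gt0; exists d; apply: step => n e' ge'.
  have mE (k : int) : (g *~ (m%:Z * k), d *~ (m%:Z * k)) \in M.
    by rewrite !mulrzA -pair_mulrz rpredMz // -!pmulrn de.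
  pose k := (n %/ m)%Z; pose r := `|(n %% m)%Z|%N.
  have rE : (n %% m)%Z = r%:Z by rewrite gez0_abs // modz_ge0 //; lia.
  have nE : n = m%:Z * k + r by rewrite -rE mulrC -divz_eq.
  have [r0|r_gt0] := posnP r.
    by move: ge'; rewrite nE r0 addr0 => /fnM; apply; apply: mE.
  suff /minm : Q r.
    by rewrite leqNgt -ltz_nat -rE ltz_pmod.
  apply/asboolP; split=> //; exists (e' - d *~ (m%:Z * k)).
  have := rpredB ge' (mE k); congr (_ \in M); congr (_, _).
  by rewrite /= nE mulrzDr addrAC subrr add0r.
have [f fP] := choice totM.
have [|h hE] := @additive_of _ _ f.
  by move=> x y; apply: fnM (fP _) _; apply: (rpredB (fP x) (fP y)).
by exists h => x d /AM xd; rewrite hE; apply: fnM (fP _) xd.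
Qed.

(** * The embedding criterion *)

Lemma subrACA (X : zmodType) (a b c d : X) : (a - b) - (c - d) = (a - c) - (b - d).
Proof. by rewrite !opprB [d - c]addrC addrACA [- b + d]addrC. Qed.

(* The embedding sends g to the class of g + h, where h in C is chosen so that
   q (g + h) = i g, modulo the kernel of q on C. *)
Lemma co_Bassian_criterion (G D : zmodType) (C : zmodClosed G)
    (i q : {additive G -> D}) :
  co_Bassian G ->
  (forall g, exists2 h, h \in C & q h = i g) ->
  (forall g, exists2 h, h \in C & q h = q g) ->
  (forall h, h \in C -> i h = 0 -> h = 0) ->
  forall g, exists2 h, h \in C & i h = q g.
Proof.
move=> cbG iC qC injC g0.
have [|H HE] := @subgroup_of _ (fun h => h \in C /\ q h = 0).
  split=> [|x y [xC qx] [yC qy]]; first by rewrite rpred0 raddf0.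
  by rewrite raddfB qx qy subrr; split=> //; apply: rpredB.
have /choice[s sP] g : exists x, x - g \in C /\ q x = i g.
  have [h1 h1C q1] := iC g; have [h2 h2C q2] := qC g.
  exists (g + (h1 - h2)); rewrite addrC addKr rpredB //; split=> //.
  by rewrite raddfD raddfB q1 q2 addrC subrK.
have sC g : s g \in C -> g \in C.
  by have [sgC _] := sP g => /rpredB /(_ sgC); rewrite opprB addrC subrK.
have [|f fE] := @additive_of _ _ (fun g => quot_proj H (s g)).
  move=> x y; apply/eqP; rewrite -subr_eq0 -!raddfB quot_proj_eq0; apply/HE.
  have [xC qx] := sP x; have [yC qy] := sP y; have [zC qz] := sP (x - y).
  split; last by rewrite (raddfB q) (raddfB q (s x)) qx qy qz raddfB subrr.
  have := rpredB zC (rpredB xC yC); congr (_ \in C).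
  by rewrite [s x - x - _]subrACA [LHS]subrACA subrr subr0.
have injf : injective f.
  apply: raddf_inj => g; rewrite fE => /eqP; rewrite quot_proj_eq0 => /HE[/sC gC].
  by have [_ ->] := sP g; apply: injC.
have [h hC qh] := qC g0.
(* The class of [h] is some [f x]; then [s x - h] lies in [C] and in the kernel of [q], so [x] is in
   [C] and [i x = q h]. *)
have /asboolP[x] : quot_proj H h \in image_of f by rewrite (cbG _ _ injf).
rewrite fE => /eqP; rewrite -subr_eq0 -raddfB quot_proj_eq0 => /HE[shC /eqP].
have [xC qx] := sP x; rewrite raddfB subr_eq0 /= qx qh => /eqP ix.
by exists x => //; apply: sC; rewrite -(subrK h (s x)) rpredD.
Qed.

(** * Fully invariant summands and surjectivity *)

Lemma fully_generalized_co_BassianE (G : zmodType) :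
  fully_generalized_co_Bassian G <-> co_Bassian G.
Proof.
split=> [fgG|cbG] H f injf; last first.
  have imf b : b \in image_of f by rewrite (cbG _ _ injf).
  split; first by move=> psi x _.
  have [|K KE] := @subgroup_of (Quotient.quot H) (fun x => x = 0).
    by split=> // x y -> ->; rewrite subrr.
  exists K; split=> [x _ /KE //|x].
  by exists x, 0; split; rewrite ?addr0 //; apply/KE.
have [inv [K [FK0 FK]]] := fgG _ _ injf.
(* The endomorphism phi(g) + k |-> (K-component of the class of g). *)
have /choice[k kP] b : exists k, k \in K /\ b - k \in image_of f.
  by have [c [k [cF kK ->]]] := FK b; exists k; rewrite addrK.
have kU b c : c \in K -> b - c \in image_of f -> k b = c.
  move=> cK bcF; have [kK bkF] := kP b; apply/eqP; rewrite -subr_eq0; apply/eqP.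
  apply: FK0; last by rewrite rpredB.
  have := rpredB bcF bkF; congr (_ \in image_of f).
  by rewrite subrACA subrr sub0r opprB.
have /choice[g gP] b : exists g, f g = b - k b.
  by have [_ /asboolP] := kP b.
have [|psi psiE] := @additive_of _ _ (fun b => k (quot_proj H (g b))).
  move=> x y; have -> : g (x - y) = g x - g y.
    apply: injf; rewrite raddfB !gP.
    have [xK xF] := kP x; have [yK yF] := kP y.
    rewrite (kU _ (k x - k y)); [exact: subrACA|exact: rpredB|].
    by rewrite -subrACA rpredB.
  have [xK xF] := kP (quot_proj H (g x)); have [yK yF] := kP (quot_proj H (g y)).
  apply: kU; first exact: rpredB.
  by rewrite raddfB -subrACA rpredB.
have kf x : k (f x) = 0.
  by apply: kU; rewrite ?rpred0 // subr0; apply/asboolP; exists x.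
have gf x : g (f x) = x by apply: injf; rewrite gP kf subr0.
move=> b; have [x xb] := quot_proj_surj b.
(* [psi (f x)] is the [K]-component of [b]; full invariance puts it in the image of [f] as well, so
   it is 0. *)
have : psi (f x) \in image_of f by apply: inv; apply/asboolP; exists x.
rewrite psiE gf xb => kbF; have [kK bkF] := kP b.
by rewrite -[b]subr0 -(FK0 _ kbF kK).
Qed.

(** * Homomorphisms on direct sums of cyclic groups *)

Definition int_span (X : zmodType) (w : nat -> X) (x : X) : Prop :=
  exists m (c : nat -> int), x = \sum_(j < m) w j *~ c j.

Lemma int_span_subgroup (X : zmodType) (w : nat -> X) : is_subgroup (int_span w).
Proof.
have pad m n (c : nat -> int) : (m <= n)%N ->
    \sum_(j < m) w j *~ c j = \sum_(j < n) w j *~ (if (j < m)%N then c j else 0).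
  move=> mn; rewrite (big_ord_widen n (fun j => w j *~ c j) mn) big_mkcond.
  by apply: eq_bigr => j _; case: ifP.
split=> [|_ _ [m [c ->]] [n [d ->]]]; first by exists 0%N, (fun=> 0); rewrite big_ord0.
exists (maxn m n).
exists (fun j => (if (j < m)%N then c j else 0) - (if (j < n)%N then d j else 0)).
rewrite (pad _ _ c (leq_maxl m n)) (pad _ _ d (leq_maxr m n)) -sumrB.
by apply: eq_bigr => j _; rewrite mulrzBr.
Qed.

Lemma int_span_gen (X : zmodType) (w : nat -> X) (j : nat) : int_span w (w j).
Proof.
exists j.+1, (fun k => (k == j)%:R).
rewrite big_ord_recr /= eqxx mulr1z big1 ?add0r // => k _.
by rewrite ltn_eqF // mulr0z.
Qed.

Lemma dvdz_mulrz0 (X : zmodType) (x : X) (o : nat) (c : int) :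
  x *+ o = 0 -> (o %| c)%Z -> x *~ c = 0.
Proof. by move=> xo /dvdzP[k ->]; rewrite mulrC mulrzA -pmulrn xo mul0rz. Qed.

(** The order [o j = 0] stands for infinite order, as 0 divides only 0. A relation among the [y j]
    modulo [A] has coefficients divisible by the [o j], so it holds among the [w j], and the graph
    [B] is single-valued. *)
Lemma extend_from_cyclic_sum (G D : zmodType) (A : zmodClosed G)
    (y : nat -> G) (o : nat -> nat) (w : nat -> D) :
  divisible D ->
  (forall m (c : nat -> int), \sum_(j < m) y j *~ c j \in A ->
     forall j, (j < m)%N -> (o j %| c j)%Z) ->
  (forall j, w j *+ o j = 0) ->
  exists f : {additive G -> D},
    (forall a, a \in A -> f a = 0) /\ (forall j, f (y j) = w j).
Proof.
move=> divD indep wo; pose z j := (y j, w j).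
have zE m c : \sum_(j < m) z j *~ c j =
    (\sum_(j < m) y j *~ c j, \sum_(j < m) w j *~ c j).
  by apply: injective_projections; rewrite /= ?(raddf_sum fst) ?(raddf_sum snd);
     apply: eq_bigr => j _; rewrite pair_mulrz.
have [|B BE] := @subgroup_of (G * D)%type
    (fun x => exists2 s, int_span z s & (x - s).1 \in A /\ (x - s).2 = 0).
  split=> [|a b [s sz [sA s0]] [t tz [tA t0]]].
    by exists 0; [exact: (int_span_subgroup z).1|rewrite subrr rpred0].
  exists (s - t); first exact: (int_span_subgroup z).2.
  rewrite subrACA; split; first exact: rpredB.
  by have -> : (a - s - (b - t)).2 = (a - s).2 - (b - t).2 by []; rewrite s0 t0 subrr.
have zB : forall s, int_span z s -> s \in B.
  by move=> s zs; apply/BE; exists s; rewrite // subrr rpred0.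
have [|f fE] := extend_to_divisible (A := B) divD.
  move=> d /BE[s [m [c ->]]]; rewrite zE /= !sub0r rpredN => -[/indep oc].
  move/eqP; rewrite subr_eq0 => /eqP->; apply: big1 => j _.
  by apply: dvdz_mulrz0 (wo _) (oc _ _).
exists f; split=> [a aA|j]; apply: fE; last by apply/zB/int_span_gen.
apply/BE; exists 0; first exact: (int_span_subgroup z).1.
by rewrite subr0.
Qed.

(* The y_j generate a direct sum of cyclic groups. If y_j |-> v_j takes every
   value that a homomorphism G -> D killing A can take, the criterion forces the
   embedding y_j |-> u_j to take these values too. *)
Lemma co_Bassian_cyclic_sum (G D : zmodType) (A : zmodClosed G)
    (y : nat -> G) (o : nat -> nat) (u v : nat -> D) (Q : D -> Prop) :
  co_Bassian G -> divisible D ->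
  (forall j, y j *+ o j = 0) ->
  (forall m (c : nat -> int), \sum_(j < m) y j *~ c j \in A ->
     forall j, (j < m)%N -> (o j %| c j)%Z) ->
  (forall j, u j *+ o j = 0) ->
  (forall m (c : nat -> int), \sum_(j < m) u j *~ c j = 0 ->
     forall j, (j < m)%N -> (o j %| c j)%Z) ->
  (forall j, v j *+ o j = 0) ->
  (forall f : {additive G -> D}, (forall a, a \in A -> f a = 0) ->
     forall g, Q (f g)) ->
  (forall d, Q d -> exists j, v j = d) ->
  forall d, Q d -> int_span u d.
Proof.
move=> cbG divD yo yA uo u0 vo fQ Qv d Qd.
have [i [iA iy]] := extend_from_cyclic_sum divD yA uo.
have [q [qA qy]] := extend_from_cyclic_sum divD yA vo.
have [C CE] := subgroup_of (int_span_subgroup y).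
have yC j : y j \in C by apply/CE/int_span_gen.
have QC e : Q e -> exists2 h, h \in C & q h = e.
  by move=> /Qv[j <-]; exists (y j); rewrite ?qy.
have iC m c : i (\sum_(j < m) y j *~ c j) = \sum_(j < m) u j *~ c j.
  by rewrite raddf_sum; apply: eq_bigr => j _; rewrite raddfMz iy.
have [j vj] := Qv _ Qd.
have iinj h : h \in C -> i h = 0 -> h = 0.
  move=> /CE[m [c ->]]; rewrite iC => /u0 oc.
  by apply: big1 => k _; apply: dvdz_mulrz0 (yo _) (oc _ _).
have [g|g|h /CE[m [c ->]]] := co_Bassian_criterion (i := i) (q := q) cbG _ _ iinj (y j).
- exact/QC/fQ.
- exact/QC/fQ.
by rewrite iC qy vj => <-; exists m, c.
Qed.

(** Dependent choice with full history: [mkseq x j] lists the terms before [x j]. *)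
Lemma dependent_sequence (T : Type) (P : seq T -> T -> Prop) :
  (forall s, exists x, P s x) ->
  exists x : nat -> T, forall j, P (mkseq x j) (x j).
Proof.
move=> /choice[nxt nxtP].
pose L := fix L n := if n is n'.+1 then rcons (L n') (nxt (L n')) else [::].
exists (fun n => nxt (L n)) => j; suff <- : L j = mkseq (fun n => nxt (L n)) j by [].
by elim: j => //= j IH; rewrite mkseqS -IH.
Qed.

(** Only the last coefficient needs control: once [o m] divides it, its term vanishes and the
    relation gets shorter. *)
Lemma independent_sequence (G : zmodType) (A : zmodClosed G) (y : nat -> G)
    (o : nat -> nat) :
  (forall j, y j *+ o j = 0) ->
  (forall m (c : nat -> int) (n : int),
     \sum_(j < m) y j *~ c j + y m *~ n \in A -> (o m %| n)%Z) ->
  forall m (c : nat -> int), \sum_(j < m) y j *~ c j \in A ->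
    forall j, (j < m)%N -> (o j %| c j)%Z.
Proof.
move=> yo top; elim=> // m IH c; rewrite big_ord_recr /= => cA.
have om := top _ _ _ cA.
move: cA; rewrite (dvdz_mulrz0 (yo m) om) addr0 => cA j.
by rewrite ltnS leq_eqVlt => /predU1P[->//|]; apply: IH.
Qed.

(** * Finiteness of the torsion-free rank *)

Lemma int_dependence (m k : nat) (c : 'I_m -> 'I_k -> int) :
  (k < m)%N ->
  exists2 a : 'I_m -> int,
    (exists i, a i != 0) & forall j, \sum_i a i * c i j = 0.
Proof.
move=> km; pose M : 'M[rat]_(m, k) := \matrix_(i, j) (c i j)%:~R.
have /rowV0Pn[v /sub_kermxP vM v0] : kermx M != 0.
  rewrite kermx_eq0 /row_free neq_ltn (leq_ltn_trans _ km) //.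
  exact: rank_leq_col.
(* [a i] is [v 0 i] times the product [b] of all denominators. *)
pose a i : int := numq (v 0 i) * \prod_(l | l != i) denq (v 0 l).
pose b : rat := \prod_l (denq (v 0 l))%:~R.
have aE i : (a i)%:~R = v 0 i * b.
  rewrite /b (bigD1 i) //= mulrA -{1}(divq_num_den (v 0 i)) divfK; last first.
    by rewrite intr_eq0 denq_neq0.
  by rewrite /a intrM rmorph_prod.
exists a => [|j].
  have /rV0Pn[i vi] := v0; exists i.
  rewrite -(intr_eq0 rat) aE mulf_neq0 //.
  by apply/prodf_neq0 => l _; rewrite intr_eq0 denq_neq0.
apply/eqP; rewrite -(intr_eq0 rat) rmorph_sum /=; apply/eqP.
transitivity ((v *m M) 0 j * b); last by rewrite vM mxE mul0r.
rewrite mxE mulr_suml; apply: eq_bigr => i _.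
by rewrite intrM aE mxE mulrAC.
Qed.

Lemma quot_torsionP (G : zmodType) (g : G) :
  reflect (exists2 n : nat, (0 < n)%N & g *+ n = 0)
    (quot_proj (@torsion G) g == 0).
Proof. by rewrite quot_proj_eq0; apply: asboolP. Qed.

(** Nonzero multiples of the elements have integer coordinates along [s]; with more elements than
    [size s], the coordinate vectors are linearly dependent. *)
Lemma bounded_rank (G : zmodType) (s : seq G) :
  (forall x, exists (c : nat -> int) (n : int), n != 0 /\
     \sum_(j < size s) s`_j *~ c j + x *~ n = 0) ->
  finite_rank (Quotient.quot (@torsion G)).
Proof.
move=> sP; exists (size s) => m x indep; rewrite leqNgt; apply/negP => sm.
have /choice[g gx] i : exists g, quot_proj (@torsion G) g = x i.
  exact: quot_proj_surj.
have /choice[c /choice[n ncP]] i := sP (g i).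
have [a [i0 ai0] aP] := int_dependence (fun i (j : 'I_(size s)) => c i j) sm.
have /indep/(_ i0)/eqP : \sum_i x i *~ (n i * a i) = 0.
  transitivity (quot_proj (@torsion G) (\sum_i g i *~ (n i * a i))).
    by rewrite raddf_sum; apply: eq_bigr => i _; rewrite raddfMz /= gx.
  rewrite -[RHS](raddf0 (quot_proj (@torsion G))); congr quot_proj.
  transitivity (- \sum_(j < size s) s`_j *~ (\sum_i a i * c i j)).
    transitivity (\sum_i - \sum_(j < size s) s`_j *~ (a i * c i j)).
      apply: eq_bigr => i _; have [_ /eqP] := ncP i.
      rewrite addrC addr_eq0 mulrzA => /eqP->; rewrite mulNrz; congr (- _).
      rewrite mulrz_suml; apply: eq_bigr => j _.
      by rewrite mulrC mulrzA.
    rewrite sumrN exchange_big /=; congr (- _); apply: eq_bigr => j _.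
    by rewrite -(raddf_sum (intmul s`_j)).
  by rewrite big1 ?oppr0 // => j _; rewrite aP mulr0z.
rewrite mulf_eq0 (negPf ai0) orbF => /eqP n0.
by have [] := ncP i0; rewrite n0 eqxx.
Qed.

(** [{poly rat}] serves as Q^(omega): countable, divisible, with one coordinate per coefficient. *)
Lemma divisible_polyrat : divisible {poly rat}.
Proof.
move=> n x n0; exists (n%:R^-1 *: x).
by rewrite -scaler_nat scalerA divff ?scale1r // pnatr_eq0 -lt0n.
Qed.

Lemma coef_sum_shift (u : nat -> rat) m (c : nat -> int) (j : nat) :
  (\sum_(i < m) (u i *: 'X^(i.+1)) *~ c i)`_j =
  if j is k.+1 then (if (k < m)%N then u k *~ c k else 0) else 0.
Proof.
rewrite coef_sum; case: j => [|k].
  by apply: big1 => i _; rewrite -scaler_int scalerA coefZ coefXn mulr0.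
have E i : ((u i *: 'X^(i.+1)) *~ c i)`_k.+1 = if i == k then u k *~ c k else 0.
  rewrite -scaler_int scalerA coefZ coefXn eqSS [k == _]eq_sym.
  by case: eqP => [->|_]; rewrite ?mulr0 // mulr1 mulrzl.
under eq_bigr do rewrite E.
case: ltnP => km.
  rewrite (bigD1 (Ordinal km)) //= eqxx big1 ?addr0 // => i.
  by rewrite -val_eqE /= => /negPf->.
by apply: big1 => i _; rewrite ltn_eqF // (leq_trans (ltn_ord i)).
Qed.

Lemma co_Bassian_finite_rank (G : zmodType) :
  co_Bassian G -> finite_rank (Quotient.quot (@torsion G)).
Proof.
move=> cbG; apply: contrapT => nfr.
pose P (s : seq G) x := forall (c : nat -> int) n,
  \sum_(j < size s) s`_j *~ c j + x *~ n = 0 -> n = 0.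
(* In infinite rank, every finite list leaves some [x] with no nonzero multiple in its span. *)
have [s|y yP] := @dependent_sequence _ P.
  apply: contrapT => nP; apply: nfr; apply: (@bounded_rank _ s) => x.
  apply: contrapT => nc; apply: nP; exists x => c n cn.
  by apply: contrapT => /eqP n0; apply: nc; exists c, n.
have [A AE] : exists A : zmodClosed G, forall x, x \in A <-> x = 0.
  by apply: subgroup_of; split=> // a b -> ->; rewrite subrr.
(* The [u j] span no polynomial with a constant term, while [v] enumerates all of [{poly rat}]; the
   criterion would put the constant 1 in the span of the [u j]. *)
pose u j : {poly rat} := 1 *: 'X^(j.+1).
pose v j : {poly rat} := odflt 0 (unpickle j).
have [| | | |m [c /(congr1 (coefp 0))]] :=
  @co_Bassian_cyclic_sum G {poly rat} A y (fun=> 0%N) u v (fun=> True)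
    cbG divisible_polyrat (fun=> mulr0n _) _
    (fun=> mulr0n _) _ (fun=> mulr0n _) _ _ 1 I.
- apply: independent_sequence => // m c n /AE cn.
  rewrite dvd0z; apply/eqP/(yP m c); rewrite size_mkseq -[RHS]cn.
  by congr (_ + _); apply: eq_bigr => j _; rewrite nth_mkseq.
- move=> m c cm j jm; have := congr1 (fun q : {poly rat} => q`_j.+1) cm.
  by rewrite (coef_sum_shift (fun=> 1)) jm coef0 dvd0z => /eqP; rewrite intr_eq0.
- by [].
- by move=> d _; exists (pickle d); rewrite /v pickleK.
by rewrite /= (coef_sum_shift (fun=> 1)) coef1.
Qed.

(** * Finiteness of the p-socle *)

Definition finite_pred (X : zmodType) (P : X -> Prop) : Prop :=
  exists s : seq X, forall x, P x -> x \in s.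

Lemma finite_pred_sub (X : zmodType) (P Q : X -> Prop) :
  (forall x, P x -> Q x) -> finite_pred Q -> finite_pred P.
Proof. by move=> PQ [s sQ]; exists s => x /PQ /sQ. Qed.

Section PrimaryPart.
Variables (p : nat) (p_pr : prime p).

Lemma combinations_finite (G : zmodType) (s : seq G) :
  (forall x, x \in s -> x *+ p = 0) ->
  exists l : seq G, forall c : nat -> int, \sum_(j < size s) s`_j *~ c j \in l.
Proof.
elim: s => [|x s IH] sp; first by exists [:: 0] => c; rewrite big_ord0 inE.
have [|l lP] := IH; first by move=> y ys; apply: sp; rewrite inE ys orbT.
exists [seq x *+ i + a | i <- iota 0 p, a <- l] => c; rewrite big_ord_recl /=.
have xp : x *+ p = 0 by apply: sp; rewrite inE eqxx.
have p0 : (0 < p)%N := prime_gt0 p_pr.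
have c0 : 0 <= (c 0%N %% p)%Z by rewrite modz_ge0 //; lia.
have -> : x *~ c 0%N = x *+ `|(c 0%N %% p)%Z|.
  rewrite {1}(divz_eq (c 0%N) p) mulrzDr mulrC mulrzA -[x *~ p]/(x *+ p) xp.
  by rewrite mul0rz add0r -{1}(gez0_abs c0).
apply: allpairs_f; last exact: (lP (fun j => c j.+1)).
by rewrite mem_iota add0n /= -ltz_nat gez0_abs // ltz_pmod //; lia.
Qed.

(** Each [x j] is chosen in [B j] outside [A] plus the span of its predecessors. This excludes only
    finitely many elements killed by [p], since both the span and the part of [A] killed by [p] are
    finite. *)
Lemma socle_sequence (G : zmodType) (A : zmodClosed G) (B : nat -> G -> Prop) :
  finite_pred (fun x => x \in A /\ x *+ p = 0) ->
  (forall j x, B j x -> x *+ p = 0) ->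
  (forall j, ~ finite_pred (B j)) ->
  exists x : nat -> G, (forall j, B j (x j)) /\
    forall m (c : nat -> int), \sum_(j < m) x j *~ c j \in A ->
      forall j, (j < m)%N -> (p %| c j)%Z.
Proof.
move=> [a aP] Bp Binf.
(* The condition on [s] makes the choice possible for every list: outside the socle it is
   vacuous. *)
pose P (s : seq G) x := (forall y, y \in s -> y *+ p = 0) ->
  B (size s) x /\ forall c : nat -> int, \sum_(j < size s) s`_j *~ c j + x \notin A.
have [s|x xP] := @dependent_sequence _ P.
  apply: contrapT => nP.
  have sp y : y \in s -> y *+ p = 0.
    by move=> ys; apply: contrapT => yp; apply: nP; exists 0 => /(_ y ys).
  have [l lP] := combinations_finite sp.
  apply: (Binf (size s)); exists [seq z - w | z <- a, w <- l] => x Bx.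
  apply: contrapT => xl; apply: nP; exists x => _; split=> // c.
  apply/negP => cA; apply: xl.
  have -> : x = \sum_(j < size s) s`_j *~ c j + x - \sum_(j < size s) s`_j *~ c j.
    by rewrite addrC addKr.
  apply: allpairs_f; last exact: lP.
  apply: aP; split=> //; rewrite mulrnDl (Bp _ _ Bx) addr0 -sumrMnl.
  apply: big1 => j _.
  by rewrite pmulrn mulrzAC -pmulrn (sp _ (mem_nth _ (ltn_ord j))) mul0rz.
have {}xP j : B j (x j) /\
    forall c : nat -> int, \sum_(i < j) x i *~ c i + x j \notin A.
  have Pj := xP j; rewrite /P size_mkseq in Pj.
  have [|Bj nA] := Pj.
    move=> y /mapP[i]; rewrite mem_iota add0n /= => ij ->.
    elim/ltn_ind: i ij => i IH ij; have := xP i; rewrite /P size_mkseq.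
    case=> [y' /mapP[k]|/Bp //]; rewrite mem_iota add0n /= => ki ->.
    by apply: IH => //; apply: ltn_trans ij.
  split=> // c; have := nA c; congr (~~ (_ + _ \in A)).
  by apply: eq_bigr => i _; rewrite nth_mkseq.
exists x; split=> [j|]; first by have [] := xP j.
apply: independent_sequence => [j|m c n]; first by have [/Bp] := xP j.
move=> cA; apply: contrapT => /negP pn.
(* Here [n] is invertible modulo [p], so a multiple of the relation puts [x m] in [A] plus the span
   of its predecessors. *)
have : coprimez n p.
  rewrite coprimez_sym /coprimez /gcdz; move: pn; rewrite dvdzE /= => pn.
  by rewrite -(prime_coprime _ p_pr) in pn; rewrite (eqP pn).
case/coprimezP => -[u w] /= uw.
have [Bm /(_ (fun j => c j * u))/negP] := xP m; apply.
have := rpredMz u cA; congr (_ \in A).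
rewrite mulrzDl mulrz_suml -mulrzA; congr (_ + _).
  by apply: eq_bigr => j _; rewrite mulrzA.
rewrite -[RHS]mulr1z -uw mulrzDr mulrC (mulrC w) (mulrzA _ p).
rewrite -[_ *~ p]/(_ *+ p).
by rewrite (Bp _ _ Bm) mul0rz addr0.
Qed.

(* Z(p^oo)^(omega) is realized as {poly rat} modulo p-integral polynomials. *)
Lemma p_integral_subgroup : is_subgroup (fun v : {poly rat} =>
  exists2 N : nat, ~~ (p %| N)%N & forall j, v`_j *+ N \in Num.int).
Proof.
split; first by exists 1%N => [|j]; rewrite ?coef0 ?mul0rn ?rpred0 // Euclid_dvd1.
move=> v w [N pN vN] [M pM wM]; exists (N * M)%N => [|j].
  by rewrite Euclid_dvdM // negb_or pN.
rewrite coefB mulrnBl rpredB //; first by rewrite mulrnA rpredMn.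
by rewrite mulnC mulrnA rpredMn.
Qed.

Lemma pfrac_int (k N : nat) (c : int) : ~~ (p %| N)%N ->
  ((p ^ k)%N%:R^-1 : rat) *~ c *+ N \in Num.int -> ((p ^ k)%N %| c)%Z.
Proof.
move=> pN /intrP[z]; rewrite -(mulrzr _ c) -(mulr_natr _ N).
have q0 : (p ^ k)%N%:R != 0 :> rat by rewrite pnatr_eq0 -lt0n expn_gt0 prime_gt0.
move=> /(congr1 (fun x : rat => (p ^ k)%N%:R * x)) /=.
rewrite -!mulrA mulVKf // !pmulrn -!intrM.
move=> /(@intr_inj rat) cN.
have : ((p ^ k)%N %| c * N)%Z by rewrite cN dvdz_mulr.
rewrite Gauss_dvdzl // coprimezE /= coprimeXl //.
by rewrite prime_coprime.
Qed.

Definition p_integral : zmodClosed {poly rat} :=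
  projT1 (cid (subgroup_of p_integral_subgroup)).

Definition Prufer_sum : zmodType := Quotient.quot p_integral.

Definition Prufer_proj : {additive {poly rat} -> Prufer_sum} :=
  quot_proj p_integral.

Lemma Prufer_proj_surj d : exists v, Prufer_proj v = d.
Proof. exact: quot_proj_surj. Qed.

Lemma Prufer_proj_eq0 v : Prufer_proj v = 0 <->
  exists2 N : nat, ~~ (p %| N)%N & forall j, v`_j *+ N \in Num.int.
Proof.
have HP := projT2 (cid (subgroup_of p_integral_subgroup)).
by rewrite -HP -quot_proj_eq0; split=> [->|/eqP].
Qed.

Lemma divisible_Prufer_sum : divisible Prufer_sum.
Proof.
move=> n d n0; have [v <-] := Prufer_proj_surj d.
by have [w <-] := divisible_polyrat v n0; exists (Prufer_proj w); rewrite raddfMn.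
Qed.

(** The p-part of the product [M] of the denominators kills [d], because the cofactor [N] is prime
    to [p]. *)
Lemma Prufer_sum_torsion (d : Prufer_sum) : exists e, d *+ (p ^ e)%N = 0.
Proof.
have [v <-] := Prufer_proj_surj d.
pose M : nat := (\prod_(j < size v) `|denq v`_j|)%N.
have M0 : (0 < M)%N by rewrite prodn_gt0 // => j; rewrite absz_gt0 denq_neq0.
have vM j : v`_j *+ M \in Num.int.
  have [sv|sv] := leqP (size v) j; first by rewrite nth_default // mul0rn rpred0.
  rewrite /M (bigD1 (Ordinal sv)) //= mulrnA rpredMn //.
  have -> : v`_j *+ `|denq v`_j| = (numq v`_j)%:~R.
    rewrite pmulrn gez0_abs ?denq_ge0 // -mulrzr -{1}[v`_j]divq_num_den divfK //.
    by rewrite intr_eq0 denq_neq0.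
  exact: intr_int.
exists (logn p M); rewrite -raddfMn; apply/Prufer_proj_eq0.
have [N pN MN] := pfactor_coprime p_pr M0.
exists N; first by rewrite -prime_coprime.
by move=> j; rewrite coefMn -mulrnA mulnC -MN.
Qed.

(** An element of order [p ^ k] in the copy of Z(p^oo) with index [j]. *)
Definition Prufer_gen (k j : nat) : Prufer_sum :=
  Prufer_proj ((p ^ k)%N%:R^-1 *: 'X^j).

Lemma Prufer_gen_order (k j : nat) : Prufer_gen k j *+ (p ^ k)%N = 0.
Proof.
rewrite -raddfMn; apply/Prufer_proj_eq0; exists 1%N => [|i].
  by rewrite Euclid_dvd1.
rewrite -scaler_nat scalerA divff ?scale1r; last first.
  by rewrite pnatr_eq0 -lt0n expn_gt0 prime_gt0.
by rewrite coefXn mulr1n rpred_nat.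
Qed.

Lemma sum_Prufer_gen (e : nat -> nat) m (c : nat -> int) :
  \sum_(j < m) Prufer_gen (e j) j.+1 *~ c j =
  Prufer_proj (\sum_(j < m) ((p ^ e j)%N%:R^-1 *: 'X^(j.+1)) *~ c j).
Proof. by rewrite raddf_sum; apply: eq_bigr => j _; rewrite -raddfMz. Qed.

Lemma Prufer_gen_independent (e : nat -> nat) m (c : nat -> int) :
  \sum_(j < m) Prufer_gen (e j) j.+1 *~ c j = 0 ->
  forall j, (j < m)%N -> ((p ^ e j)%N %| c j)%Z.
Proof.
rewrite sum_Prufer_gen => /Prufer_proj_eq0[N pN cN] j jm.
apply: (pfrac_int pN); have := cN j.+1.
by rewrite (coef_sum_shift (fun j => (p ^ e j)%N%:R^-1)) jm.
Qed.

(** The generators use only coordinates of positive index, and 1/p is not p-integral in coordinate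
    0. *)
Lemma Prufer_gen0_notin_int_span (e : nat -> nat) :
  ~ int_span (fun j => Prufer_gen (e j) j.+1) (Prufer_gen 1 0).
Proof.
move=> [m [c /eqP]]; rewrite sum_Prufer_gen -subr_eq0 -raddfB => /eqP.
move=> /Prufer_proj_eq0[N pN /(_ 0%N)].
rewrite coefB (coef_sum_shift (fun j => (p ^ e j)%N%:R^-1)) subr0 coefZ coefXn mulr1.
rewrite -[_^-1]mulr1z => /(pfrac_int pN) /=.
by rewrite expn1 dvdzE dvdn1 => /eqP p1; have := p_pr; rewrite -[p]/(`|p|%N) p1.
Qed.

(** Independence is asked only of the socle elements [y j *+ p ^ e j]. The [y j] are embedded along
    the coordinates of positive index, so coordinate 0 holds an element that the embedding
    misses. *)
Lemma co_Bassian_p_sum (G : zmodType) (A : zmodClosed G) (y : nat -> G)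
    (e : nat -> nat) (v : nat -> Prufer_sum) (Q : Prufer_sum -> Prop) :
  co_Bassian G ->
  (forall j, y j *+ (p ^ (e j).+1)%N = 0) ->
  (forall m (c : nat -> int), \sum_(j < m) y j *+ (p ^ e j)%N *~ c j \in A ->
     forall j, (j < m)%N -> (p %| c j)%Z) ->
  (forall j, v j *+ (p ^ (e j).+1)%N = 0) ->
  (forall f : {additive G -> Prufer_sum}, (forall a, a \in A -> f a = 0) ->
     forall g, Q (f g)) ->
  (forall d, Q d -> exists j, v j = d) ->
  ~ Q (Prufer_gen 1 0).
Proof.
move=> cbG yo yA vo fQ Qv Q0.
apply: (@Prufer_gen0_notin_int_span (fun j => (e j).+1)).
apply: (co_Bassian_cyclic_sum (o := fun j => (p ^ (e j).+1)%N)
  (y := y) (A := A)) (fQ) (Qv) _ Q0 => //.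
- exact: divisible_Prufer_sum.
- move=> m c cA.
  (* Descent on [t]: dividing [p ^ t * c j] by [p ^ e j] gives a relation among socle elements,
     whose coefficients are divisible by [p]. For large [t] the premise is automatic. *)
  have step t : (forall j, (j < m)%N -> ((p ^ (e j).+1)%N %| p%:Z ^+ t * c j)%Z) ->
      forall j, (j < m)%N -> ((p ^ (e j).+1)%N %| c j)%Z.
    elim: t => [|t IH] tc; first by move=> j /tc; rewrite mul1r.
    apply: IH.
    pose c' j := ((p%:Z ^+ t * c j) %/ (p ^ e j)%N)%Z.
    have cE j : (j < m)%N -> p%:Z ^+ t * c j = (p ^ e j)%N%:Z * c' j.
      move=> jm; rewrite [RHS]mulrC divzK //; have := tc _ jm.
      rewrite exprS -mulrA expnS PoszM dvdz_mul2l //.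
      by have := prime_gt0 p_pr; lia.
    have c'A : \sum_(j < m) y j *+ (p ^ e j)%N *~ c' j \in A.
      have := rpredMz (p%:Z ^+ t) cA; congr (_ \in A).
      rewrite mulrz_suml; apply: eq_bigr => j _.
      by rewrite -mulrzA mulrC cE // mulrzA -pmulrn.
    move=> j jm; rewrite cE // expnSr PoszM dvdz_mul //.
    exact: (yA _ _ c'A).
  apply: (step (\sum_(j < m) (e j).+1)%N) => j jm.
  apply: dvdz_mulr; rewrite dvdzE /= abszX /= dvdn_exp2l //.
  by rewrite (bigD1 (Ordinal jm)) //= leq_addr.
- by move=> j; apply: Prufer_gen_order.
- exact: (@Prufer_gen_independent (fun j => (e j).+1)).
Qed.

(** [S n] is the part of the socle of p-height at least [n]. If all [S n] are infinite, the orders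
    of the [y j] can be large enough for an arbitrary enumeration [w]. Otherwise the last infinite
    [S k] gives [y j] of order [p ^ k.+1], and maps killing [p ^ k.+1] times [G] take values killed
    by [p ^ k.+1]. *)
Lemma co_Bassian_finite_socle (G : zmodType) :
  co_Bassian G -> finite_pred (fun x : G => x *+ p = 0).
Proof.
move=> cbG; apply: contrapT => infG.
pose S n (x : G) := x *+ p = 0 /\ exists y, y *+ (p ^ n)%N = x.
have Sp n x : S n x -> x *+ p = 0 by case.
pose w j : Prufer_sum := Prufer_proj (odflt 0 (unpickle j)).
have w_onto d : exists j, w j = d.
  by have [v <-] := Prufer_proj_surj d; exists (pickle v); rewrite /w pickleK.
have [Sinf|/existsNP[n /contrapT Sfin]] := pselect (forall n, ~ finite_pred (S n)).
  have [A AE] : exists A : zmodClosed G, forall x, x \in A <-> x = 0.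
    by apply: subgroup_of; split=> // a b -> ->; rewrite subrr.
  have /choice[e eP] j := Prufer_sum_torsion (w j).
  have [|x [xS xA]] :=
    @socle_sequence G A (fun j => S (e j)) _ (fun j => @Sp _) (fun j => Sinf _).
    by exists [:: 0] => x [/AE->]; rewrite inE.
  have /choice[y yx] j : exists y, y *+ (p ^ e j)%N = x j by have [_] := xS j.
  apply: (@co_Bassian_p_sum G A y e w (fun=> True)) => //.
  - by move=> j; rewrite expnSr mulrnA yx; have [] := xS j.
  - move=> m c cA; apply: xA; move: cA; congr (_ \in A).
    by apply: eq_bigr => j _; rewrite yx.
  - by move=> j; rewrite expnSr mulrnA eP mul0rn.
have exS : exists n, `[< finite_pred (S n) >] by exists n; apply/asboolP.
(* The least [n] with [S n] finite is positive, as [S 0] is the whole socle. *)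
case: (ex_minnP exS) => [[|k] /asboolP Sk mink].
  apply: infG; apply: finite_pred_sub Sk => x xp; split=> //.
  by exists x; rewrite mulr1n.
have [A AE] : exists A : zmodClosed G,
    forall x, x \in A <-> exists y, y *+ (p ^ k.+1)%N = x.
  apply: subgroup_of; split=> [|_ _ [a <-] [b <-]]; first by exists 0; rewrite mul0rn.
  by exists (a - b); rewrite mulrnBl.
have [||x [xS xA]] := @socle_sequence G A (fun j => S k) _ (fun j => @Sp _) _.
- by apply: finite_pred_sub Sk => x [/AE].
- by move=> _ /asboolP /mink; rewrite ltnn.
have /choice[y yx] j : exists y, y *+ (p ^ k)%N = x j by have [_] := xS j.
(* An enumeration of the elements killed by [p ^ k.+1], with 0 in place of all others. *)
pose v j := if w j *+ (p ^ k.+1)%N == 0 then w j else 0.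
apply: (@co_Bassian_p_sum G A y (fun=> k) v (fun d => d *+ (p ^ k.+1)%N = 0)) => //.
- by move=> j; rewrite expnSr mulrnA yx; have [] := xS j.
- move=> m c cA; apply: xA; move: cA; congr (_ \in A).
  by apply: eq_bigr => j _; rewrite yx.
- by move=> j; rewrite /v; case: eqP => // _; rewrite mul0rn.
- by move=> f fA g; rewrite -raddfMn fA //; apply/AE; exists g.
- move=> d dp; have [j wj] := w_onto d; exists j; rewrite /v wj dp eqxx //.
by rewrite expnS mulrnA -[X in _ *+ X *+ _]expn1 Prufer_gen_order mul0rn.
Qed.

End PrimaryPart.

(** * Complements of the p-torsion and divisibility modulo torsion *)

Section Divisibility.
Variables (p : nat) (p_pr : prime p) (G : zmodType).

Lemma prime_order_mem (M : zmodClosed G) (x : G) (n : int) :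
  x *+ p = 0 -> ~~ (p %| n)%Z -> x *~ n \in M -> x \in M.
Proof.
move=> xp pn xn; have : coprimez n p.
  by rewrite coprimez_sym coprimezE /= prime_coprime // -dvdzE.
case/coprimezP => -[u w] /= uw.
rewrite -[x]mulr1z -uw mulrzDr (mulrC u) (mulrC w) !mulrzA -[x *~ p]/(x *+ p).
by rewrite xp mul0rz addr0 rpredMz.
Qed.

Definition p_torsion (x : G) := exists k, x *+ (p ^ k)%N = 0.

Lemma p_torsion_subgroup : is_subgroup p_torsion.
Proof.
split=> [|x y [k xk] [l yl]]; first by exists 0%N; rewrite mul0rn.
exists (k + l)%N; rewrite expnD mulrnBl mulrnA xk mul0rn.
by rewrite mulnC mulrnA yl mul0rn subrr.
Qed.

Lemma p_torsionD x y : p_torsion x -> p_torsion y -> p_torsion (x + y).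
Proof.
have [T TE] := subgroup_of p_torsion_subgroup.
by move=> /TE xT /TE yT; apply/TE; apply: rpredD.
Qed.

Lemma p_torsionMz x n : p_torsion x -> p_torsion (x *~ n).
Proof.
have [T TE] := subgroup_of p_torsion_subgroup.
by move=> /TE xT; apply/TE; apply: rpredMz.
Qed.

(* C' is maximal among the subgroups of C that avoid x and, if x has finite
   p-height n - 1 in C, contain p^n C; so C/C' is cocyclic with socle generated
   by x, and p-power torsion elements of C dividing x generate C/C'. *)
Lemma remove_socle_element (C : zmodClosed G) (x : G) :
  x \in C -> x *+ p = 0 -> x != 0 ->
  exists C' : zmodClosed G, [/\ {subset C' <= C}, x \notin C'
    & forall g, g \in C -> exists2 t, p_torsion t & g - t \in C'].
Proof.
move=> xC xp x0.
have [A [AC xA Ah]] : exists A : zmodClosed G, [/\ {subset A <= C}, x \notin A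
    & forall k, (exists2 y, y \in C & y *+ (p ^ k)%N = x) \/
                (forall g, g \in C -> g *+ (p ^ k)%N \in A)].
  have [inf|/existsNP[n0 n0P]] :=
    pselect (forall k, exists2 y, y \in C & y *+ (p ^ k)%N = x).
    have [A AE] : exists A : zmodClosed G, forall x, x \in A <-> x = 0.
      by apply: subgroup_of; split=> // a b -> ->; rewrite subrr.
    exists A; split=> [a /AE->||k]; [exact: rpred0| |by left].
    by apply/negP => /AE /eqP; rewrite (negPf x0).
  have exn : exists n, `[< ~ exists2 y, y \in C & y *+ (p ^ n)%N = x >].
    by exists n0; apply/asboolP.
  case: (ex_minnP exn) => n /asboolP nP minn.
  have [A AE] : exists A : zmodClosed G,
      forall a, a \in A <-> exists2 y, y \in C & y *+ (p ^ n)%N = a.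
    apply: subgroup_of; split=> [|_ _ [a aC <-] [b bC <-]].
      by exists 0; rewrite ?rpred0 ?mul0rn.
    by exists (a - b); rewrite ?rpredB ?mulrnBl.
  exists A; split=> [_ /AE[y yC <-]||k]; first by rewrite rpredMn.
    by apply/negP => /AE.
  have [kn|nk] := ltnP k n.
    left; apply: contrapT => nk; have := minn k; rewrite leqNgt kn => /(_ _).
    by move=> h; have : false by apply: h; apply/asboolP.
  right=> g gC; apply/AE; exists (g *+ (p ^ (k - n))%N); first exact: rpredMn.
  by rewrite -mulrnA -expnD subnK.
(* Forbidding the elements outside [C] keeps [M] inside [C]. *)
have [|M [AM MS maxM]] := @maximal_avoiding _ A (fun z => z \notin C \/ z = x).
  by move=> a aA [|ax]; [rewrite AC|rewrite -ax aA in xA].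
have MC a : a \in M -> a \in C.
  by move=> /MS; apply: contra_notT; left.
have xM : x \notin M by apply/negP => /MS; apply; right.
have stepM g : g \in C -> g \notin M -> exists n, x - g *~ n \in M.
  move=> gC /maxM[c cM [n [|cx]]].
    by rewrite rpredD ?rpredMz //; apply: MC.
  by exists n; rewrite -cx addrK.
(* Induction on [k]: modulo [M], [g *+ p ^ k] is a multiple [x *~ u]; if [x] is [y *+ p ^ k], then
   subtracting [y *~ u] from [g] lowers the exponent. *)
have splitM k : forall g, g \in C -> g *+ (p ^ k)%N \in M ->
    exists2 t, p_torsion t & g - t \in M.
  elim: k => [|k IH] g gC gM.
    exists 0; last by rewrite subr0.
    by exists 0%N; rewrite mul0rn.
  have [|gkM] := boolP (g *+ (p ^ k)%N \in M); first exact: IH.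
  have [n xgn] := stepM _ (rpredMn _ gC) gkM.
  have pn : ~~ (p %| n)%Z.
    apply/negP => /dvdzP[m nE]; case/negP: xM.
    rewrite -(subrK (g *+ (p ^ k)%N *~ n) x) rpredD // nE mulrC mulrzA.
    by rewrite -[_ *~ p]/(_ *+ p) -mulrnA -expnSr rpredMz.
  have : coprimez n p.
    by rewrite coprimez_sym coprimezE /= prime_coprime // -dvdzE.
  case/coprimezP => -[u w] /= uw.
  have xugM : x *~ u - g *+ (p ^ k)%N \in M.
    have -> : x *~ u - g *+ (p ^ k)%N =
        (x - g *+ (p ^ k)%N *~ n) *~ u - (g *+ (p ^ k)%N) *+ p *~ w.
      rewrite mulrzBl -addrA -opprD; congr (_ - _).
      by rewrite -[_ *+ p]/(_ *~ p%:Z) -!mulrzA -mulrzDr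
        (mulrC n) (mulrC _ w) uw mulr1z.
    by rewrite rpredB ?rpredMz // -mulrnA -expnSr.
  have [[y yC yx]|kA] := Ah k; last by rewrite AM ?kA in gkM.
  have yT : p_torsion y by exists k.+1; rewrite expnSr mulrnA yx.
  have [||t tT tM] := IH (g - y *~ u).
  - by rewrite rpredB ?rpredMz.
  - rewrite mulrnBl pmulrn [y *~ u *+ _]pmulrn mulrzAC -!pmulrn yx.
    by rewrite -opprB rpredN.
  exists (y *~ u + t); last by rewrite opprD addrA.
  by apply: p_torsionD => //; apply: p_torsionMz.
exists M; split=> // g gC.
have [gM|gM] := boolP (g \in M); first by apply: (splitM 0%N).
have [n xgn] := stepM _ gC gM.
have n0 : n != 0.
  by apply: contraNneq xM => n0; move: xgn; rewrite n0 mulr0z subr0.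
have gnpM : g *~ (n * p) \in M.
  have := rpredMn p xgn; rewrite mulrnBl xp sub0r rpredN pmulrn -mulrzA.
  by [].
have np_gt0 : (0 < `|(n * p)%R|)%N.
  by rewrite absz_gt0 mulf_neq0 // -lt0n prime_gt0.
have [N pN NE] := pfactor_coprime p_pr np_gt0.
apply: (splitM (logn p `|(n * p)%R|) g gC); apply/negPn/negP => gkM.
have [m xgm] := stepM _ (rpredMn _ gC) gkM.
case/negP: xM; apply: (@prime_order_mem _ _ N xp).
  by rewrite dvdzE /= -prime_coprime.
have := rpredMn N xgm; rewrite mulrnBl => xN.
rewrite -pmulrn -(subrK (g *+ (p ^ logn p `|(n * p)%R|)%N *~ m *+ N) (x *+ N)) rpredD //.
rewrite pmulrn mulrzAC -pmulrn rpredMz // -mulrnA mulnC -NE.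
case: (n * p) gnpM => k //=.
by rewrite NegzE mulrNz rpredN.
Qed.

(** Starting from all of [G], nonzero elements killed by [p] are removed one at a time; [C] has
    finitely many, and [G] remains the sum of [C] and its p-torsion. *)
Lemma p_torsion_complement :
  finite_pred (fun x : G => x *+ p = 0) ->
  exists C : zmodClosed G, (forall x, x \in C -> x *+ p = 0 -> x = 0) /\
    forall g, exists2 t, p_torsion t & g - t \in C.
Proof.
move=> [s sP].
have [T TE] : exists T : zmodClosed G, forall x, x \in T <-> True.
  exact: subgroup_of.
suff: forall n (C : zmodClosed G),
    (count (fun x => x \in C) (undup [seq x : G <- s | x != 0%R]) <= n)%N ->
    (forall g, exists2 t, p_torsion t & g - t \in C) ->
    exists C : zmodClosed G, (forall x, x \in C -> x *+ p = 0 -> x = 0) /\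
      forall g, exists2 t, p_torsion t & g - t \in C.
  apply; first exact: leqnn; move=> g; exists 0; last exact/TE.
  by exists 0%N; rewrite mul0rn.
elim=> [|n IH] C Cn CT.
  exists C; split=> // x xC xp; apply/eqP; apply: contraLR Cn => x0.
  rewrite -ltnNge -has_count; apply/hasP; exists x => //.
  by rewrite mem_undup mem_filter x0 sP.
have [C0|] := pselect (forall x, x \in C -> x *+ p = 0 -> x = 0); first by exists C.
move=> /existsNP[x /not_implyP[xC /not_implyP[xp /eqP x0]]].
have [C' [C'C xC' C'T]] := remove_socle_element xC xp x0.
apply: (IH C'); last first.
  move=> g; have [t tT gC] := CT g; have [t' t'T gC'] := C'T _ gC.
  by exists (t + t'); [exact: p_torsionD|rewrite opprD addrA].
rewrite -ltnS (leq_trans _ Cn) //.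
set l := undup _; have xl : x \in l by rewrite mem_undup mem_filter x0 sP.
have [l1 [l2 lE]] : exists l1 l2, l = l1 ++ x :: l2.
  exists (take (index x l) l), (drop (index x l).+1 l).
  by rewrite -drop_index // cat_take_drop.
rewrite lE !count_cat /= xC (negPf xC') add0n add1n addnS ltnS.
by rewrite leq_add ?sub_count // => z; apply: C'C.
Qed.

(** The criterion applies with [q] the projection modulo p-torsion and [i] its p-th multiple, which
    is injective on a complement [C]. *)
Lemma co_Bassian_p_divisible :
  co_Bassian G -> forall g : G, exists h, p_torsion (g - h *+ p).
Proof.
move=> cbG g; have [C [C0 CT]] := p_torsion_complement (co_Bassian_finite_socle p_pr cbG).
have [T TE] := subgroup_of p_torsion_subgroup.
have [|i iE] := @additive_of _ _ (fun x => quot_proj T (x *+ p)).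
  by move=> x y; rewrite mulrnBl raddfB.
have qC d : exists2 h, h \in C & quot_proj T h = d.
  have [x <-] := quot_proj_surj d; have [t /TE tT xtC] := CT x.
  exists (x - t) => //; apply/eqP; rewrite -subr_eq0 -raddfB quot_proj_eq0.
  by rewrite addrAC subrr sub0r rpredN.
have iinj x : x \in C -> i x = 0 -> x = 0.
  move=> xC; rewrite iE => /eqP; rewrite quot_proj_eq0 => /TE[k].
  rewrite -mulrnA -expnS; elim: k => [|k IH]; first by rewrite expn1; apply: C0.
  by rewrite expnSr mulrnA => /C0 h; apply: IH; apply: h; apply: rpredMn.
have [x|x|h hC] := co_Bassian_criterion (i := i) (q := quot_proj T) cbG _ _ iinj g.
- exact: qC.
- exact: qC.
rewrite iE => /esym/eqP; rewrite -subr_eq0 -raddfB quot_proj_eq0 => /TE ghT.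
by exists h.
Qed.

End Divisibility.

Lemma co_Bassian_divisible (G : zmodType) :
  co_Bassian G -> divisible (Quotient.quot (@torsion G)).
Proof.
move=> cbG; elim/ltn_ind=> n IH x n0.
have [->|n1] := eqVneq n 1%N; first by exists x.
have p_pr : prime (pdiv n) by rewrite pdiv_prime // ltn_neqAle eq_sym n1.
have [g <-] := quot_proj_surj x.
have [h [k ghk]] := co_Bassian_p_divisible p_pr cbG g.
have m0 : (0 < n %/ pdiv n)%N by rewrite divn_gt0 ?pdiv_gt0 // pdiv_leq.
have mn : (n %/ pdiv n < n)%N by rewrite ltn_Pdiv // prime_gt1.
have [y yE] := IH _ mn (quot_proj _ h) m0.
exists y; rewrite -{1}(divnK (pdiv_dvd n)) mulrnA yE -raddfMn.
apply/eqP; rewrite eq_sym -subr_eq0 -raddfB; apply/quot_torsionP.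
by exists (pdiv n ^ k)%N; rewrite // expn_gt0 pdiv_gt0.
Qed.

(** * Finite torsion and the torsion of a quotient *)

(** For [m = k * p], multiplication by [k] sends the elements killed by [m] into those killed by
    [p], and two elements with the same image differ by one killed by [k]. *)
Lemma finite_torsion_bound (G : zmodType) :
  (forall p, prime p -> finite_pred (fun x : G => x *+ p = 0)) ->
  forall m, (0 < m)%N -> finite_pred (fun x : G => x *+ m = 0).
Proof.
move=> finp; elim/ltn_ind=> m IH m0.
have [->|m1] := eqVneq m 1%N; first by exists [:: 0] => x; rewrite mulr1n inE => ->.
have p_pr : prime (pdiv m) by rewrite pdiv_prime // ltn_neqAle eq_sym m1.
set p := pdiv m in p_pr; pose k := (m %/ p)%N.
have k0 : (0 < k)%N by rewrite divn_gt0 ?pdiv_gt0 // pdiv_leq.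
have km : (k < m)%N by rewrite ltn_Pdiv // prime_gt1.
have mE : m = (k * p)%N by rewrite divnK // pdiv_dvd.
have [s1 s1P] := finp _ p_pr; have [s2 s2P] := IH _ km k0.
have /choice[r rP] (z : G) : exists r, (exists y, y *+ k = z) -> r *+ k = z.
  by have [[y yz]|nz] := pselect (exists y, y *+ k = z); [exists y|exists 0].
exists [seq r z + w | z <- s1, w <- s2] => x; rewrite mE mulrnA => xm.
rewrite -(subrKC (r (x *+ k)) x); apply: allpairs_f; first exact: s1P.
by apply: s2P; rewrite mulrnBl rP ?subrr //; exists x.
Qed.

Lemma finite_torsion_subgroup (G : zmodType) (K : zmodClosed G) (l : seq G) :
  {subset l <= @torsion G} -> {subset l <= K} ->
  exists S : seq G, [/\ 0 \in S, {in S &, forall x y, x - y \in S},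
    {subset l <= S} & {subset S <= K}].
Proof.
elim: l => [|z l IH] lT lK.
  exists [:: 0]; split=> [|x y|//|x]; rewrite !inE //.
    by move=> /eqP-> /eqP->; rewrite subrr.
  by move/eqP->; apply: rpred0.
have [||S [S0 SB lS SK]] := IH; first by move=> x xl; apply: lT; rewrite inE xl orbT.
  by move=> x xl; apply: lK; rewrite inE xl orbT.
have zK : z \in K by apply: lK; rewrite inE eqxx.
have /asboolP[N N0 zN] : z \in @torsion G by apply: lT; rewrite inE eqxx.
have zS a i : a \in S -> a + z *+ i \in [seq a + z *+ i | a <- S, i <- iota 0 N].
  move=> aS; have -> : z *+ i = z *+ (i %% N).
    by rewrite {1}(divn_eq i N) mulrnDr mulnC mulrnA zN mul0rn add0r.
  by apply: allpairs_f => //; rewrite mem_iota /= add0n ltn_mod.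
exists [seq a + z *+ i | a <- S, i <- iota 0 N]; split.
- by have := zS 0 0%N S0; rewrite mulr0n addr0.
- move=> _ _ /allpairsP[[a i] /= [aS iN ->]] /allpairsP[[b j] /= [bS jN ->]].
  have jN' : (j <= N)%N by move: jN; rewrite mem_iota /= => /ltnW.
  have -> : a + z *+ i - (b + z *+ j) = a - b + z *+ (i + (N - j)).
    by rewrite opprD addrACA mulrnDr mulrnBr // zN sub0r.
  exact/zS/SB.
- move=> x; rewrite inE => /predU1P[->|xl].
    by have := zS 0 1%N S0; rewrite mulr1n add0r.
  by have := zS x 0%N (lS _ xl); rewrite mulr0n addr0.
by move=> _ /allpairsP[[a i] /= [aS iN ->]]; rewrite rpredD ?rpredMn // SK.
Qed.

(* |pi S| <= |S/mS| = |S[m]| *)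
Lemma quotient_count (G B : zmodType) (f : {additive G -> B}) (S F : seq G)
    (Y : seq B) (m : nat) :
  0 \in S -> {in S &, forall x y, x - y \in S} ->
  {in S, forall x, f x *+ m = 0} ->
  {in S, forall x, x *+ m = 0 -> x \in F} ->
  uniq Y -> {subset Y <= [seq f x | x <- S]} -> (size Y <= size F)%N.
Proof.
move=> S0 SB fm SF uY YS.
pose S' := undup S; pose mS := undup [seq x *+ m | x <- S].
have mSP t : t \in mS -> exists2 x, x \in S & t = x *+ m.
  by rewrite mem_undup => /mapP.
have /choice[r rP] t : exists x, t \in mS -> x \in S /\ x *+ m = t.
  have [/mSP[x xS ->]|] := boolP (t \in mS); first by exists x.
  by exists 0.
have /choice[s sP] y : exists x, y \in Y -> x \in S /\ f x = y.
  have [/YS/mapP[x xS ->]|] := boolP (y \in Y); first by exists x.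
  by exists 0.
have mS0 : (0 < size mS)%N.
  rewrite -has_predT; apply/hasP; exists 0 => //.
  by rewrite mem_undup; apply/mapP; exists 0; rewrite ?mul0rn.
(* [x] is determined by [x *+ m] and its difference from a chosen element with the same multiple. *)
have le1 : (size S' <= size mS * size F)%N.
  rewrite -(size_map (fun x => (x *+ m, x - r (x *+ m))) S').
  rewrite -(size_allpairs pair mS F); apply: uniq_leq_size.
    rewrite map_inj_in_uniq ?undup_uniq // => x y _ _ [xy].
    by rewrite xy => /addIr.
  move=> t /mapP[x]; rewrite mem_undup => xS ->.
  have xmS : x *+ m \in mS by rewrite mem_undup; apply/mapP; exists x.
  have [rS rm] := rP _ xmS.
  by apply: allpairs_f => //; apply: SF; rewrite ?SB // mulrnBl rm subrr.
(* [f] kills [mS], so [s y + t] determines [y], and then [t]. *)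
have le2 : (size Y * size mS <= size S')%N.
  rewrite -(size_allpairs (fun y t => s y + t) Y mS); apply: uniq_leq_size.
    apply: allpairs_uniq => //; first exact: undup_uniq.
    move=> _ _ /allpairsP[[y t] /= [yY tS ->]] /allpairsP[[y' t'] /= [yY' tS' ->]] /= e.
    have ft u : u \in mS -> f u = 0 by move=> /mSP[x xS ->]; rewrite raddfMn fm.
    have yy' : y = y'.
      have [_ <-] := sP _ yY; have [_ <-] := sP _ yY'.
      by move: (congr1 f e); rewrite !raddfD /= (ft t) // (ft t') // !addr0.
    by move: e; rewrite yy' => /addrI->.
  move=> _ /allpairsP[[y t] /= [/sP[yS _] /mSP[x xS ->] ->]].
  rewrite mem_undup -[_ *+ _]opprK SB //.
  elim: m {fm SF mS mSP r rP mS0 le1} => [|m IH]; first by rewrite mulr0n oppr0.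
  by rewrite mulrS opprD addrC SB.
by rewrite -(leq_pmul2r mS0) (leq_trans le2) // mulnC.
Qed.

(** If [b] were missed, [b] and the images of [F] would be [size F + 1] elements killed by [m]. As
    [H] is torsion, their lifts generate a finite subgroup, and [quotient_count] gives a
    contradiction. *)
Lemma torsion_in_image (G : zmodType) (H : zmodClosed G)
    (f : {additive G -> Quotient.quot H}) (m : nat) (b : Quotient.quot H) :
  injective f -> {subset H <= @torsion G} ->
  (0 < m)%N -> finite_pred (fun x : G => x *+ m = 0) ->
  b *+ m = 0 -> exists x, f x = b.
Proof.
move=> injf HT m0 [s sP] bm; apply: contrapT => nb.
pose F := undup [seq x <- s | x *+ m == 0].
have FP x : (x \in F) = (x *+ m == 0).
  by rewrite mem_undup mem_filter andb_idr // => /eqP /sP.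
pose Y := b :: [seq f x | x <- F].
have uY : uniq Y.
  rewrite /= map_inj_uniq ?undup_uniq // andbT; apply/mapP => -[x _ bx].
  by apply: nb; exists x.
have Ym y : y \in Y -> y *+ m = 0.
  rewrite inE => /predU1P[->//|/mapP[x]]; rewrite FP => /eqP xm ->.
  by rewrite -raddfMn xm raddf0.
have [K KE] : exists K : zmodClosed G, forall x, x \in K <-> quot_proj H x *+ m = 0.
  apply: subgroup_of; split=> [|x y xm ym]; first by rewrite raddf0 mul0rn.
  by rewrite raddfB mulrnBl xm ym subrr.
have /choice[g gP] := @quot_proj_surj G H.
have [|x /mapP[y yY ->]|S [S0 SB lS SK]] :=
    @finite_torsion_subgroup G K [seq g y | y <- Y].
- move=> _ /mapP[y yY ->]; have /eqP : quot_proj H (g y *+ m) = 0.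
    by rewrite raddfMn /= gP Ym.
  rewrite quot_proj_eq0 => /HT/asboolP[N N0 gN].
  by apply/asboolP; exists (m * N)%N; rewrite ?muln_gt0 ?m0 // mulrnA.
- by apply/KE; rewrite gP Ym.
suff: (size Y <= size F)%N by rewrite /= size_map ltnn.
apply: (quotient_count (f := quot_proj H) (m := m) S0 SB) => //.
- by move=> x /SK /KE.
- by move=> x _ /eqP; rewrite FP.
by move=> y yY; rewrite -(gP y); apply/map_f/lS/map_f.
Qed.

(** * Maximal independent families and surjectivity of the embedding *)

Section Rank.
Variable G : zmodType.

Definition independent_mod_torsion (m : nat) (g : nat -> G) :=
  forall c : nat -> int, \sum_(j < m) g j *~ c j \in @torsion G ->
    forall j, (j < m)%N -> c j = 0.

Lemma independent_quot m (g : nat -> G) :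
  independent_mod_torsion m g ->
  independent (fun i : 'I_m => quot_proj (@torsion G) (g i)).
Proof.
move=> ig c cg i.
pose c' j := if insub j is Some k then c k else 0.
have c'E k : c' (val k) = c k by rewrite /c' valK.
rewrite -c'E; apply: (ig c') (ltn_ord i); rewrite -quot_proj_eq0 raddf_sum.
apply/eqP; rewrite -[RHS]cg; apply: eq_bigr => k _.
by rewrite c'E raddfMz.
Qed.

Lemma maximal_independent :
  finite_rank (Quotient.quot (@torsion G)) ->
  exists k g, independent_mod_torsion k g /\
    forall g', ~ independent_mod_torsion k.+1 g'.
Proof.
move=> [n nP].
pose P k := `[< exists g, independent_mod_torsion k g >].
have exP : exists k, P k.
  by exists 0%N; apply/asboolP; exists (fun=> 0) => c _ [].
have leP k : P k -> (k <= n)%N.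
  by move=> /asboolP[g /independent_quot]; apply: nP.
have [k /asboolP[g gi] maxk] := ex_maxnP exP leP.
exists k, g; split=> // g' g'i.
suff /maxk : P k.+1 by rewrite ltnn.
by apply/asboolP; exists g'.
Qed.

Lemma finite_rank_co_Bassian :
  divisible (Quotient.quot (@torsion G)) ->
  finite_rank (Quotient.quot (@torsion G)) ->
  (forall p, prime p -> finite_pred (fun x : G => x *+ p = 0)) ->
  co_Bassian G.
Proof.
move=> divG /maximal_independent[k [g [gi maxg]]] finG H f injf b.
have finT := finite_torsion_bound finG.
(* Lifts of the images of a maximal independent family; injectivity of [f] keeps them independent
   modulo [H]. *)
have /choice[g' g'P] j : exists x, quot_proj H x = f (g j).
  exact: quot_proj_surj.
have fE (c : nat -> int) : quot_proj H (\sum_(j < k) g' j *~ c j) =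
    f (\sum_(j < k) g j *~ c j).
  by rewrite !raddf_sum; apply: eq_bigr => j _; rewrite !raddfMz /= g'P.
have g'i (c : nat -> int) N : (0 < N)%N -> (\sum_(j < k) g' j *~ c j) *+ N \in H ->
    forall j, (j < k)%N -> c j = 0.
  move=> N0; rewrite -quot_proj_eq0 raddfMn /= fE -raddfMn raddf_eq0 // => cN.
  by apply: gi; apply/asboolP; exists N => //; apply/eqP.
pose ext x j := if (j < k)%N then g' j else x.
have extE x (c : nat -> int) : \sum_(j < k.+1) ext x j *~ c j =
    \sum_(j < k) g' j *~ c j + x *~ c k.
  rewrite big_ord_recr /= {2}/ext ltnn; congr (_ + _).
  by apply: eq_bigr => j _; rewrite /ext ltn_ord.
(* A non-torsion element of [H] would extend [g'] to [k.+1] elements independent modulo torsion. *)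
have HT : {subset H <= @torsion G}.
  move=> h hH; apply: contrapT => /negP hT; apply: (maxg (ext h)) => c.
  rewrite extE => /asboolP[N N0 cN].
  have c0 : forall j, (j < k)%N -> c j = 0.
    apply: (g'i _ N) => //; move/eqP: cN; rewrite mulrnDl addr_eq0 => /eqP->.
    by rewrite rpredN rpredMn // rpredMz.
  move=> j; rewrite ltnS leq_eqVlt => /predU1P[->|/c0 //].
  apply/eqP; apply: contraNT hT => ck; apply/asboolP.
  exists (`|c k| * N)%N; first by rewrite muln_gt0 absz_gt0 ck.
  move: cN; rewrite big1 => [|i _]; last by rewrite c0 ?mulr0z.
  rewrite add0r mulrnA; case: (c k) => n //=.
  by rewrite NegzE mulrNz mulNrn => /eqP; rewrite oppr_eq0 => /eqP.
have torsionB (d : Quotient.quot H) m : (0 < m)%N -> d *+ m = 0 -> exists x, f x = d.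
  by move=> m0; apply: torsion_in_image (finT _ m0).
have [x xb] := quot_proj_surj b.
(* By maximality, a lift [x] of [b] depends on [g'], which puts a positive multiple of [b] in the
   image of [f]. *)
have [c [N [N0 cN] ck]] : exists c : nat -> int,
    exists2 N, (0 < N)%N /\ (\sum_(j < k) g' j *~ c j + x *~ c k) *+ N = 0
      & c k != 0.
  apply: contrapT => nc; apply: (maxg (ext x)) => c.
  rewrite extE => cT; have /asboolP[N N0 cN] := cT.
  have ck : c k = 0.
    by apply/eqP; apply: contrapT => /negP ck; apply: nc; exists c, N.
  move=> j; rewrite ltnS leq_eqVlt => /predU1P[->//|]; apply: (g'i _ N) => //.
  by move: cN; rewrite ck mulr0z addr0 => ->; apply: rpred0.
have [M M0 [a ab]] : exists2 M, (0 < M)%N & exists a, f a = b *+ M.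
  have := congr1 (quot_proj H) cN.
  rewrite raddf0 raddfMn raddfD raddfMz /= fE xb mulrnDl => /eqP.
  rewrite addr_eq0 -raddfMn; set a := (X in f X) => /eqP fa.
  exists (`|c k| * N)%N; first by rewrite muln_gt0 absz_gt0 ck.
  case: (c k) fa => n /=; rewrite mulrnA => fa.
    by exists (- a); rewrite raddfN fa opprK.
  by exists a; rewrite fa NegzE mulrNz mulNrn opprK.
(* With [a] and [z *+ M] equal modulo torsion, [b - f z] is torsion, hence in the image of [f]. *)
have [z0 z0M] := divG M (quot_proj _ a) M0.
have [z zz0] := quot_proj_surj z0.
have /quot_torsionP[N' N'0 aN'] : quot_proj (@torsion G) (a - z *+ M) == 0.
  by rewrite raddfB raddfMn /= zz0 z0M subrr.
have [||w wE] := torsionB (b - f z) (M * N')%N.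
- by rewrite muln_gt0 M0.
- by rewrite mulrnA mulrnBl -ab -raddfMn -raddfB -raddfMn aN' raddf0.
by apply/asboolP; exists (w + z); rewrite raddfD wE subrK.
Qed.

End Rank.

(** * Finite dimension of the socle and the final equivalences *)

(** The list of all vectors spans, so there is a shortest spanning family; it is a basis, and its
    coordinates give the isomorphism. *)
Lemma finite_lmod_vector (F : fieldType) (V : lmodType F) (s : seq V) :
  (forall v, v \in s) -> exists n, inhabited (Vector.axiom n V).
Proof.
move=> sP.
pose spans n (t : 'I_n -> V) := forall v, exists c : 'rV[F]_n, v = \sum_i c 0 i *: t i.
have exn : exists n, `[< exists t : 'I_n -> V, spans n t >].
  exists (size s); apply/asboolP; exists (fun i => s`_i) => v.
  have vs : (index v s < size s)%N by rewrite index_mem.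
  exists (delta_mx 0 (Ordinal vs)).
  rewrite (bigD1 (Ordinal vs)) //= mxE !eqxx scale1r nth_index // big1 ?addr0 //.
  by move=> i iv; rewrite mxE (negPf iv) andbF scale0r.
case: (ex_minnP exn) => n /asboolP[t tP] minn.
have inj (c : 'rV[F]_n) : \sum_i c 0 i *: t i = 0 -> c = 0.
  move=> ct; apply/eqP; apply: contrapT => /negP /rV0Pn[i ci].
  case: n i t tP minn c ct ci => [[]//|n] i t tP minn c ct ci.
  suff /minn : `[< exists t : 'I_n -> V, spans n t >] by rewrite ltnn.
  apply/asboolP; exists (t \o lift i) => v; have [d ->] := tP v.
  (* The multiple of the relation [c] that cancels coordinate [i] is subtracted from [d]. *)
  exists (\row_j (d 0 (lift i j) - d 0 i / c 0 i * c 0 (lift i j))).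
  have -> : \sum_j d 0 j *: t j = \sum_j (d 0 j - d 0 i / c 0 i * c 0 j) *: t j.
    transitivity (\sum_j d 0 j *: t j - (d 0 i / c 0 i) *: \sum_j c 0 j *: t j).
      by rewrite ct scaler0 subr0.
    rewrite scaler_sumr -sumrB; apply: eq_bigr => j _.
    by rewrite scalerBl scalerA.
  rewrite (bigD1_ord i) //= divfK // subrr scale0r add0r.
  by apply: eq_bigr => j _; rewrite mxE.
have /choice[f fP] := tP.
have fK (c : 'rV[F]_n) : f (\sum_i c 0 i *: t i) = c.
  apply/eqP; rewrite eq_sym -subr_eq0; apply/eqP/inj.
  transitivity (\sum_i c 0 i *: t i - \sum_i f (\sum_i c 0 i *: t i) 0 i *: t i).
    by rewrite -sumrB; apply: eq_bigr => i _; rewrite !mxE scalerBl.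
  by rewrite -fP subrr.
exists n; constructor; exists f.
  move=> a u v; rewrite -[RHS]fK; congr f.
  rewrite {1}(fP u) {1}(fP v) scaler_sumr -big_split /=.
  by apply: eq_bigr => i _; rewrite !mxE scalerDl scalerA.
by exists (fun c : 'rV[F]_n => \sum_i c 0 i *: t i) => [v|]; [rewrite -fP|exact: fK].
Qed.

Lemma socleP (G : zmodType) (p : nat) (p_pr : prime p) (x : G) :
  reflect (x *+ p = 0) (x \in @socle G p).
Proof.
apply: (iffP andP) => [[_ /eqP //]|xp]; split; last exact/eqP.
apply/andP; split; apply/asboolP; last by exists 1%N; rewrite expn1.
by exists p => //; apply: prime_gt0.
Qed.

Lemma finite_p_rankP (G : zmodType) (p : nat) (p_pr : prime p) :
  finite_p_rank G p_pr <-> finite_pred (fun x : G => x *+ p = 0).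
Proof.
split=> [[n [[v2r _ [r2v v2rK _]]]]|[s sP]].
  exists [seq val (r2v r) | r <- enum 'rV['F_p]_n] => x /(socleP p_pr) xS.
  apply/mapP; exists (v2r (SocleSpace p_pr xS)); first by rewrite mem_enum.
  by rewrite v2rK.
apply: (@finite_lmod_vector 'F_p (socle_space G p_pr) (pmap insub s)) => v.
rewrite mem_pmap_sub; apply/sP/(socleP p_pr).
exact: valP.
Qed.

Theorem theorem3p5 (G : zmodType) :
  (fully_generalized_co_Bassian G <-> co_Bassian G) /\
  (co_Bassian G <->
     divisible (Quotient.quot (@torsion G)) /\
     finite_rank (Quotient.quot (@torsion G)) /\
     forall (p : nat) (p_pr : prime p), finite_p_rank G p_pr).
Proof.
split; first exact: fully_generalized_co_BassianE.
split=> [cbG|[divG [rkG finG]]].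
  split; first exact: co_Bassian_divisible.
  split; first exact: co_Bassian_finite_rank.
  by move=> p p_pr; apply/finite_p_rankP/co_Bassian_finite_socle.
apply: finite_rank_co_Bassian => // p p_pr.
exact/(finite_p_rankP _ p_pr)/finG.
Qed.
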